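(* Let $\mathcal{H}=\Delta+V$ be a positive Schrödinger operator associated to a connected graph $b$ over $(X,m)$ with potential $V\le1$. Assume that $\Delta+\alpha$ is subcritical for some $\alpha\in\mathbb{R}$, and that $u$ is an $\mathcal{H}$-harmonic function satisfying $u\in O(G_\alpha)$ and $$\liminf_{x\to\infty}\frac{|u(x)|}{G_1(x)}=0.$$ Then $u=0$.
   Context: Setting. $X$ is an infinite countable set with the discrete topology (compact subsets are the finite subsets), and $m:X\to(0,\infty)$ is a strictly positive function, regarded as a measure of full support. A graph $b$ over $(X,m)$ is a symmetric function $b:X\times X\to[0,\infty)$ with zero diagonal and $\sum_{y\in X}b(x,y)<\infty$ for all $x\in X$. Write $x\sim y$ if $b(x,y)>0$; $b$ is connected if any two vertices are joined by a finite path $x=x_0\sim\dots\sim x_n=y$. Let $\mathcal{F}_b=\{f:X\to\mathbb{R}\mid \sum_{y}b(x,y)|f(y)|<\infty \text{ for all }x\in X\}$. The Laplacian is $\Delta f(x)=\Delta_{b,m}f(x)=\frac1{m(x)}\sum_{y\in X}b(x,y)(f(x)-f(y))$ for $f\in\mathcal{F}_b$. A potential is a function $V:X\to\mathbb{R}$, and the Schrödinger operator associated to $b$ and $V$ is $\mathcal{H}f=\Delta f+Vf$, $f\in\mathcal{F}_b$. A function $u$ is $\mathcal{H}$-harmonic (resp. superharmonic) if $u\in\mathcal{F}_b$ and $\mathcal{H}u=0$ (resp. $\ge0$) on $X$. A function $f$ is called positive if $f\ge0$ and $f\neq0$, strictly positive (written $f>0$) if $f(x)>0$ for all $x$. $\mathcal{H}$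 is positive if there is a positive $\mathcal{H}$-superharmonic function on $X$; equivalently, the energy form $\mathcal{Q}(\varphi)=\frac12\sum_{x,y}b(x,y)(\varphi(x)-\varphi(y))^2+\sum_x m(x)V(x)\varphi(x)^2$ is nonnegative for all finitely supported $\varphi$. A positive $\mathcal{H}$ is subcritical if there is a nontrivial $W\ge0$ with $\mathcal{Q}(\varphi)\ge\sum_x m(x)W(x)\varphi(x)^2$ for all finitely supported $\varphi$. Fix a vertex $o\in X$ and let $1_o$ be the characteristic function of $\{o\}$. For $\alpha\in\mathbb{R}$ such that $\Delta+\alpha$ is subcritical (which holds for every $\alpha>0$), the Green function $G_\alpha$ of $\Delta+\alpha$ at $o$ is the smallest strictly positive function $\phi$ with $(\Delta+\alpha)\phi\ge1_o$; it satisfies $(\Delta+\alpha)G_\alpha=1_o$. The limit $x\to\infty$ is taken in the one-point compactification $X\cup\{\infty\}$ (i.e. $x$ leaves every finite set). For $g$ not vanishing outside a finite set, $f\in O(g)$ means $\limsup_{x\to\infty}|f(x)|/|g(x)|<\infty$. *)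

(* Defs.v *)
From HB Require Import structures.
From mathcomp Require Import all_boot all_order all_algebra.
From mathcomp Require Import all_classical all_reals all_analysis.

Set Implicit Arguments.
Unset Strict Implicit.
Unset Printing Implicit Defensive.

Import Order.TTheory GRing.Theory Num.Theory.
Local Open Scope classical_set_scope.
Local Open Scope ring_scope.

Section graphs.
Context {R : realType} {X : discreteTopologicalType}.
Implicit Types (b : X -> X -> R) (m V W f g u phi G : X -> R) (o : X) (alpha : R).

(* Unordered sum of an absolutely summable real family; esum alone is only
   meaningful for nonnegative terms. *)
Definition sum_abs f : R :=
  fine (esum [set: X] (EFin \o f)^\+)%E - fine (esum [set: X] (EFin \o f)^\-)%E.

Record is_graph b : Prop := IsGraph {
  graph_ge0 : forall x y, 0 <= b x y ;
  graph_sym : forall x y, b x y = b y x ;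
  graph_diag : forall x, b x x = 0 ;
  graph_summable : forall x, (\esum_(y in [set: X]) (b x y)%:E < +oo)%E }.

Definition edge b : rel X := fun x y => 0 < b x y.

Definition graph_connected b : Prop :=
  forall x y, exists p : seq X, path (edge b) x p /\ last x p = y.

Definition formal_domain b : set (X -> R) :=
  [set f | forall x, (\esum_(y in [set: X]) (b x y * `|f y|)%:E < +oo)%E].

Definition laplacian b m f : X -> R :=
  fun x => (m x)^-1 * sum_abs (fun y => b x y * (f x - f y)).

Definition schrodinger b m V f : X -> R :=
  fun x => laplacian b m f x + V x * f x.

Definition schrodinger_harmonic b m V u : Prop :=
  formal_domain b u /\ forall x, schrodinger b m V u x = 0.

Definition schrodinger_superharmonic b m V u : Prop :=
  formal_domain b u /\ forall x, 0 <= schrodinger b m V u x.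

Definition positive_fun f : Prop := (forall x, 0 <= f x) /\ f <> cst 0.

Definition strictly_positive_fun f : Prop := forall x, 0 < f x.

Definition positive_op b m V : Prop :=
  exists u, positive_fun u /\ schrodinger_superharmonic b m V u.

Definition finitely_supported phi : Prop := finite_set [set x | phi x != 0].

(* Only used for finitely supported phi, for which the double sum is finite
   and the second sum has finitely many nonzero terms. *)
Definition energy b m V phi : R :=
  2^-1 * fine (\esum_(p in [set: X * X])
                 (b p.1 p.2 * (phi p.1 - phi p.2) ^+ 2)%:E)%E
  + \sum_(x \in [set: X]) m x * V x * phi x ^+ 2.

Definition subcritical b m V : Prop :=
  positive_op b m V /\
  exists W, positive_fun W /\
    forall phi, finitely_supported phi ->
      \sum_(x \in [set: X]) m x * W x * phi x ^+ 2 <= energy b m V phi.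

Definition green_candidate b m alpha o : set (X -> R) :=
  [set phi | [/\ formal_domain b phi, strictly_positive_fun phi &
     forall x, \1_[set o] x <= schrodinger b m (cst alpha) phi x]].

Definition is_green b m alpha o G : Prop :=
  green_candidate b m alpha o G /\
  forall phi, green_candidate b m alpha o phi -> forall x, G x <= phi x.

(* The smallest candidate is unique when it exists, so xget picks it; the
   default value cst 0 is returned when there is no smallest candidate. *)
Definition green b m alpha o : X -> R :=
  xget (cst 0) [set G | is_green b m alpha o G].

(* Trace on X of the neighbourhoods of the point at infinity in the one-point
   compactification: the compact subsets of the discrete space X are its
   finite subsets. *)
Definition at_infty : set_system X := [set A | cofinite_set A].

(* Quotient form of f = O(g), meaningful when g has no zeros outside a finite
   set. The library's =O_ bounds |f| by a multiple of |g| instead. *)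
Definition in_bigO f g : Prop :=
  (limf_esup (fun x => (`|f x| / `|g x|)%:E) at_infty < +oo)%E.

End graphs.

(* Main.v *)
Require Import Defs.
From mathcomp Require Import all_boot all_order all_algebra.
From mathcomp Require Import finmap.
From mathcomp Require Import all_classical all_reals all_analysis.
From mathcomp Require Import ring lra.

Import Order.TTheory GRing.Theory Num.Theory.
Import numFieldNormedType.Exports.
Local Open Scope classical_set_scope.
Local Open Scope ring_scope.

Set Implicit Arguments.
Unset Strict Implicit.

(** A harmonic function [u] of constant sign cannot violate the claim: if
[u > 0], then [V <= 1] makes [u] superharmonic for Delta + 1, and the minimum
of [G_1] and [(G_1 o / u o) u] is again an admissible competitor in the
definition of [G_1], so that [|u| / G_1] is bounded below
([green_le_supersol]).  The same applies to [- u].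

It remains to see that [u] has constant sign, which is a Liouville comparison
principle.  Let [G = G_alpha] and let [g_n] be finitely supported functions
increasing to [G] whose energies are at most [m o * g_n o].  By the ground
state representation ([qform_ground_state]) the cutoffs [phi_n = g_n / G],
which increase to 1, satisfy
  1/2 sum b(x,y) G(x) G(y) (phi_n x - phi_n y)^2
    <= m o * (g_n o - g_n o ^ 2 / G o) -> 0.
The positive part [w] of [u] is a subsolution for Delta + V with [w <= C G], so
the energy of [w phi_n] is at most [C ^ 2] times the same quantity
([qform_comparison]).  On the other hand, if [v > 0] is superharmonic for
Delta + V, this energy is at least
  1/2 sum b(x,y) v(x) v(y) ((w phi_n / v) x - (w phi_n / v) y)^2
([qform_supersol]).  Letting n tend to infinity, [w / v] takes the same value
at the two ends of every edge, hence is constant ([ratio_constant]): [w]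
vanishes identically or is strictly positive everywhere ([harmonic_sign]).

The functions [g_n] come from finite problems: [g_n] solves
(Delta + alpha + 1/(n+1)) g_n = 1_o on the n-th set of an exhaustion and is 0
elsewhere.  It is obtained by Perron's method; the extra term 1/(n+1) turns any
strictly positive superharmonic function into a strict supersolution, so that
the finite problem is feasible on every finite set, connected or not.  The
[g_n] increase, lie below every competitor for the Green function, and are
bounded as soon as they are bounded at [o], by Harnack's inequality along
paths.  The bound at [o] comes from the constant competitor 1 when alpha = 1
and from the Hardy weight when Delta + alpha is subcritical
([approx_bounded_subcritical]).  Their limit is then the Green function
([green_approx]).

Nonnegative functions are handled after multiplication by [m]: Delta + c becomes
[d f x - sum_y b x y * f y] with [d x = deg x + m x * c x], and an inequality
(Delta + c) f >= s is expressed through finite partial sums only ([supersol]).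
*)

(** * Sums of nonnegative families *)
Section nonnegative_sums.
Context {R : realType} {X : choiceType}.
Implicit Types (h k : X -> R) (s : seq X).

Definition finite_tsum h : Prop := (\esum_(y in [set: X]) (h y)%:E < +oo)%E.

Definition tsum h : R := fine (\esum_(y in [set: X]) (h y)%:E)%E.

Lemma esum_le_finite_sums h (c : R) :
  (forall s, uniq s -> \sum_(y <- s) h y <= c) ->
  (\esum_(y in [set: X]) (h y)%:E <= c%:E)%E.
Proof.
move=> hc; apply: ge_ereal_sup => _ [A [finA _] <-].
rewrite fsbig_finite//= sumEFin lee_fin.
by apply: hc; exact: fset_uniq.
Qed.

Lemma tsum_fin h : (forall y, 0 <= h y) -> finite_tsum h ->
  (tsum h)%:E = (\esum_(y in [set: X]) (h y)%:E)%E.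
Proof.
move=> h0 hs; rewrite /tsum fineK// ge0_fin_numE//.
by apply: esum_ge0 => y _; rewrite lee_fin.
Qed.

Lemma finite_sum_le_esum h s : uniq s ->
  ((\sum_(y <- s) h y)%:E <= \esum_(y in [set: X]) (h y)%:E)%E.
Proof.
move=> us; apply: ereal_sup_ubound; exists [set` s] => //.
by rewrite -fsbig_seq// sumEFin.
Qed.

Lemma finite_sum_le_tsum h s : (forall y, 0 <= h y) -> finite_tsum h -> uniq s ->
  \sum_(y <- s) h y <= tsum h.
Proof. by move=> h0 hs us; rewrite -lee_fin tsum_fin// finite_sum_le_esum. Qed.

Lemma finite_tsum_le h (c : R) : (forall s, uniq s -> \sum_(y <- s) h y <= c) -> finite_tsum h.
Proof.
by move=> hc; apply: le_lt_trans (ltry c); exact: esum_le_finite_sums.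
Qed.

Lemma tsum_le h (c : R) : (forall y, 0 <= h y) ->
  (forall s, uniq s -> \sum_(y <- s) h y <= c) -> tsum h <= c.
Proof.
move=> h0 hc; rewrite -lee_fin tsum_fin//; last exact: finite_tsum_le hc.
exact: esum_le_finite_sums.
Qed.

Lemma tsum_ge0 h : (forall y, 0 <= h y) -> 0 <= tsum h.
Proof. by move=> h0; apply/fine_ge0/esum_ge0 => y _; rewrite lee_fin. Qed.

Lemma finite_tsum_dominated h k : (forall y, h y <= k y) -> finite_tsum k -> finite_tsum h.
Proof.
move=> hk; apply: le_lt_trans; apply: le_esum => y _; by rewrite lee_fin.
Qed.

Lemma finite_tsumD h k : (forall y, 0 <= h y) -> (forall y, 0 <= k y) ->
  finite_tsum h -> finite_tsum k -> finite_tsum (fun y => h y + k y).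
Proof.
move=> h0 k0 hs ks; rewrite /finite_tsum.
under eq_esum do rewrite EFinD.
by rewrite esumD ?lte_add_pinfty// => y _; rewrite lee_fin.
Qed.

Lemma tsumD h k : (forall y, 0 <= h y) -> (forall y, 0 <= k y) ->
  finite_tsum h -> finite_tsum k -> tsum (fun y => h y + k y) = tsum h + tsum k.
Proof.
move=> h0 k0 hs ks; apply: EFin_inj; rewrite EFinD !tsum_fin//.
- under eq_esum do rewrite EFinD.
  by rewrite esumD// => y _; rewrite lee_fin.
- by move=> y; rewrite addr_ge0.
- exact: finite_tsumD.
Qed.

Lemma finite_tsumZ (c : R) h : 0 <= c -> (forall y, 0 <= h y) ->
  finite_tsum h -> finite_tsum (fun y => c * h y).
Proof.
move=> c0 h0 hs; apply: (@finite_tsum_le _ (c * tsum h)) => s us.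
by rewrite -mulr_sumr ler_wpM2l// finite_sum_le_tsum.
Qed.

Lemma tsumZ (c : R) h : 0 <= c -> (forall y, 0 <= h y) -> finite_tsum h ->
  tsum (fun y => c * h y) = c * tsum h.
Proof.
have half (a : R) k : 0 <= a -> (forall y, 0 <= k y) -> finite_tsum k ->
    tsum (fun y => a * k y) <= a * tsum k.
  move=> a0 k0 ks; apply: tsum_le => [y|s us]; first by rewrite mulr_ge0.
  by rewrite -mulr_sumr ler_wpM2l// finite_sum_le_tsum.
rewrite le_eqVlt => /predU1P[<- h0 hs|c0 h0 hs].
  apply/le_anti; rewrite half//= mul0r tsum_ge0// => y.
  by rewrite mul0r.
have c0' := ltW c0.
apply/le_anti; rewrite half//= -ler_pdivlMl//.
have := half c^-1 (fun y => c * h y).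
rewrite invr_ge0 c0' => /(_ isT).
rewrite [in X in _ -> _ -> X <= _](_ : (fun y => _) = h).
  by apply => [y|]; [rewrite mulr_ge0|apply: finite_tsumZ].
by apply/funext => y; rewrite mulKf ?gt_eqF.
Qed.

Lemma sum_restrict s t h : uniq s -> uniq t -> {subset s <= t} ->
  (forall y, y \notin s -> h y = 0) -> \sum_(y <- t) h y = \sum_(y <- s) h y.
Proof.
move=> us ut st h0; rewrite (bigID (mem s))/= [X in _ + X]big1 ?addr0; last first.
  by move=> y ys; exact: h0.
rewrite -big_filter; apply/perm_big/uniq_perm => //; first exact: filter_uniq.
move=> y; rewrite mem_filter; apply/andP/idP => [[]//|ys]; split=> //; exact: st.
Qed.

(** Comparison of two unrelated index lists: enlarging both to their union
changes the second sum by nothing and the first one upwards. *)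
Lemma sum_uniq_le_support s t h : uniq s -> uniq t -> (forall y, 0 <= h y) ->
  (forall y, y \notin s -> h y = 0) -> \sum_(y <- t) h y <= \sum_(y <- s) h y.
Proof.
move=> us ut h0 hs.
have st : uniq (undup (s ++ t)) by exact: undup_uniq.
rewrite -(@sum_restrict s (undup (s ++ t)))//; last first.
  by move=> y ys; rewrite mem_undup mem_cat ys.
rewrite [leRHS](bigID (mem t))/= -[leLHS]addr0 lerD ?sumr_ge0//.
rewrite -[leRHS]big_filter le_eqVlt; apply/orP; left; apply/eqP/perm_big.
apply: uniq_perm => //; first exact: filter_uniq.
move=> y; rewrite mem_filter mem_undup mem_cat.
by case: (y \in t); rewrite ?orbT.
Qed.

Lemma tsum_support s h : uniq s -> (forall y, 0 <= h y) ->
  (forall y, y \notin s -> h y = 0) -> finite_tsum h /\ tsum h = \sum_(y <- s) h y.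
Proof.
move=> us h0 hs.
have bnd t : uniq t -> \sum_(y <- t) h y <= \sum_(y <- s) h y.
  by move=> ut; exact: sum_uniq_le_support.
have hsum : finite_tsum h by exact: finite_tsum_le bnd.
by split=> //; apply/le_anti; rewrite tsum_le//= finite_sum_le_tsum.
Qed.

(** This removes the positive and negative parts from the unordered sum of a
signed family, once the family is a difference of two summable nonnegative
ones. *)
Lemma tsumB h k : (forall y, 0 <= h y) -> (forall y, 0 <= k y) ->
  finite_tsum h -> finite_tsum k ->
  fine (esum [set: X] (EFin \o (fun y => h y - k y)%R)^\+)%E
  - fine (esum [set: X] (EFin \o (fun y => h y - k y)%R)^\-)%E
  = tsum h - tsum k.
Proof.
move=> h0 k0 hs ks.
have smb (f : X -> R) : (forall y, 0 <= f y) -> finite_tsum f -> summable [set: X] (EFin \o f).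
  move=> f0; rewrite /finite_tsum /summable; congr (_ < _)%E.
  by apply: eq_esum => y _; rewrite /= ger0_norm.
have := @esumB R X [set: X] (EFin \o h) (EFin \o k) (smb h h0 hs) (smb k k0 ks).
have -> : ((EFin \o h)%FUN \- (EFin \o k)%FUN)%E = (EFin \o (fun y => (h y - k y)%R))%FUN.
  by apply/funext => y.
move=> /(_ (fun y _ => h0 y) (fun y _ => k0 y)) E.
have fin (p : X -> \bar R) (f : X -> R) : (forall y, 0 <= f y) -> finite_tsum f ->
    (forall y, 0 <= p y)%E -> (forall y, (p y <= (f y)%:E)%E) ->
    esum [set: X] p \is a fin_num.
  move=> f0 fs p0 pf; rewrite ge0_fin_numE ?esum_ge0//.
  by apply: le_lt_trans fs; apply: le_esum => y _.
rewrite -fineB.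
- by rewrite E fineB// ge0_fin_numE// esum_ge0// => y _; rewrite lee_fin.
- apply: (fin _ h) => // y; rewrite ?funepos_ge0// funeposE /= -EFin_max lee_fin.
  by rewrite ge_max h0 andbT lerBlDr lerDl.
- apply: (fin _ k) => // y; rewrite ?funeneg_ge0// funenegE /= -EFin_max lee_fin.
  by rewrite ge_max k0 andbT opprB lerBlDr lerDl.
Qed.

End nonnegative_sums.

(** * Operators and supersolutions *)
Section operators.
Context {R : realType} {X : discreteTopologicalType}.
Implicit Types (b : X -> X -> R) (m c d s f g h p q : X -> R) (x y o : X)
  (F K : seq X).

Definition adj b f x : R := tsum (fun y => b x y * f y).

Definition diagonal b m c x : R := tsum (b x) + m x * c x.

Definition in_domain b f : Prop := forall x, finite_tsum (fun y => b x y * f y).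

(** For [f >= 0] this is [(Delta + c) f >= s / m], with [d = diagonal b m c],
together with membership in the domain: bounding all finite partial sums bounds the series. *)
Definition supersol b d s f : Prop := forall x F, uniq F ->
  s x + \sum_(y <- F) b x y * f y <= d x * f x.

(** The energy form, with the diagonal part [deg + m c] of [m (Delta + c)] given
as [d], on functions supported in [K]. *)
Definition qform b K d f : R := \sum_(x <- K) d x * f x ^+ 2 -
  \sum_(x <- K) \sum_(y <- K) b x y * f x * f y.

(** The sum in the Laplacian of [p - q] is rearranged as the difference of the
nonnegative families [b p(x) + b q(y)] and [b q(x) + b p(y)]. *)
Lemma schrodinger_split b m c p q x : is_graph b -> 0 < m x ->
  (forall y, 0 <= p y) -> (forall y, 0 <= q y) ->
  in_domain b p -> in_domain b q ->
  m x * schrodinger b m c (fun y => p y - q y) x =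
  diagonal b m c x * (p x - q x) - (adj b p x - adj b q x).
Proof.
move=> bg mx p0 q0 dp dq; have b0 := graph_ge0 bg.
have bs : finite_tsum (b x) by exact: graph_summable bg x.
have bp a : 0 <= a -> (forall y, 0 <= a * b x y) /\ finite_tsum (fun y => a * b x y).
  by move=> a0; split=> [y|]; [rewrite mulr_ge0|exact: finite_tsumZ].
have [h0 hs] := bp _ (p0 x); have [k0 ks] := bp _ (q0 x).
have nonneg g : (forall y, 0 <= g y) -> forall y, 0 <= b x y * g y.
  by move=> g0 y; rewrite mulr_ge0.
rewrite /schrodinger /laplacian mulrDr mulVKf ?gt_eqF// /sum_abs.
have -> : (fun y => b x y * (p x - q x - (p y - q y))) =
   (fun y => (p x * b x y + b x y * q y) - (q x * b x y + b x y * p y)).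
  by apply/funext => y; ring.
rewrite tsumB; first last.
- by apply: finite_tsumD => //; exact: nonneg.
- by apply: finite_tsumD => //; exact: nonneg.
- by move=> y; rewrite addr_ge0// nonneg.
- by move=> y; rewrite addr_ge0// nonneg.
rewrite !tsumD ?tsumZ//; try exact: nonneg; try exact: dp; try exact: dq.
by rewrite /diagonal /adj; ring.
Qed.

Lemma in_domain0 b : in_domain b (fun=> 0).
Proof.
move=> x; apply: (@finite_tsum_le _ _ _ 0) => F uF.
by rewrite big1// => y _; rewrite mulr0.
Qed.

Lemma adj0 b x : adj b (fun=> 0) x = 0.
Proof.
rewrite /adj /tsum esum1// => y _; by rewrite mulr0.
Qed.

Lemma schrodinger_ge0E b m c f x : is_graph b -> 0 < m x ->
  (forall y, 0 <= f y) -> in_domain b f ->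
  m x * schrodinger b m c f x = diagonal b m c x * f x - adj b f x.
Proof.
move=> bg mx f0 df; have := @schrodinger_split b m c f (fun=> 0) x bg mx f0.
rewrite adj0 !subr0 => <-//; last exact: in_domain0.
by congr (_ * schrodinger _ _ _ _ _); apply/funext => y; rewrite subr0.
Qed.

Lemma formal_domain_ge0 b f : (forall y, 0 <= f y) ->
  formal_domain b f = in_domain b f.
Proof.
move=> f0; rewrite /formal_domain /in_domain /finite_tsum /=; congr (forall x, _).
by apply/funext => x; congr (_ < _)%E; apply: eq_esum => y _; rewrite ger0_norm.
Qed.

Lemma supersol_in_domain b d s f : supersol b d s f -> in_domain b f.
Proof.
move=> sf x; apply: (@finite_tsum_le _ _ _ (d x * f x - s x)) => F uF.
by rewrite lerBrDl sf.
Qed.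

Lemma supersol_adj b d s f x : is_graph b -> (forall y, 0 <= f y) ->
  supersol b d s f -> s x + adj b f x <= d x * f x.
Proof.
move=> bg f0 sf; rewrite -lerBrDl; apply: tsum_le => [y|F uF].
  by rewrite mulr_ge0// graph_ge0.
by rewrite lerBrDl sf.
Qed.

Lemma supersolP b m c s f : is_graph b -> (forall x, 0 < m x) ->
  (forall y, 0 <= f y) ->
  (formal_domain b f /\ (forall x, s x <= schrodinger b m c f x)) <->
  supersol b (diagonal b m c) (fun x => m x * s x) f.
Proof.
move=> bg m0 f0; rewrite formal_domain_ge0//; split=> [[df sf] x F uF|sf].
  have := sf x; rewrite -(ler_pM2l (m0 x)) schrodinger_ge0E// lerBrDr.
  apply: le_trans; rewrite lerD2l finite_sum_le_tsum// => y.
  by rewrite mulr_ge0// graph_ge0.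
have df := supersol_in_domain sf; split=> // x.
by rewrite -(ler_pM2l (m0 x)) schrodinger_ge0E// lerBrDr (supersol_adj x bg f0 sf).
Qed.

Lemma graph_connected_ind b (P : X -> Prop) x y : graph_connected b ->
  P x -> (forall z w, P z -> 0 < b z w -> P w) -> P y.
Proof.
move=> bc Px step; have [F [pF <-]] := bc x y.
elim: F x Px pF => //= z F IH x Px /andP[xz pF].
by apply: IH pF; exact: step xz.
Qed.

(** Strong minimum principle: at a zero of [f] the inequality forces [f] to
vanish at all neighbours, hence everywhere by connectedness. *)
Lemma supersol_gt0 b d s f : is_graph b -> graph_connected b ->
  (forall x, 0 <= s x) -> (forall x, 0 <= f x) -> supersol b d s f ->
  f <> cst 0 -> forall x, 0 < f x.
Proof.
move=> bg bc s0 f0 sf fn0 x; rewrite lt_neqAle f0 andbT eq_sym.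
apply/eqP => fx0; apply: fn0; apply/funext => y /=.
apply: (@graph_connected_ind b (fun z => f z = 0) x y bc) => // z w fz0 zw.
have := sf z [:: w] isT; rewrite big_seq1 fz0 mulr0 => le0.
apply/le_anti; rewrite f0 andbT -(pmulr_rle0 _ zw).
by apply: le_trans le0; rewrite lerDr.
Qed.

Lemma green_candidateP b m alpha o f : is_graph b -> (forall x, 0 < m x) ->
  green_candidate b m alpha o f <->
  (forall x, 0 < f x) /\
  supersol b (diagonal b m (cst alpha)) (fun x => m x * \1_[set o] x) f.
Proof.
move=> bg m0; split=> [[df f0 sf]|[f0 sf]].
  by split=> //; apply/supersolP => // x; exact/ltW/f0.
have [|df sf'] := (supersolP (cst alpha) (\1_[set o]) bg m0 _).2 sf.
  by move=> x; exact/ltW.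
by split.
Qed.

Lemma positive_op_supersol b m c : is_graph b -> (forall x, 0 < m x) ->
  graph_connected b -> positive_op b m c ->
  exists v, (forall x, 0 < v x) /\ supersol b (diagonal b m c) (cst 0) v.
Proof.
move=> bg m0 bc [v [[v0 vn0] [dv sv]]].
have sv' : supersol b (diagonal b m c) (cst 0) v.
  move=> x F; have := (supersolP c (cst 0) bg m0 v0).1 (conj dv sv) x F.
  by rewrite /= mulr0.
by exists v; split=> //; apply: supersol_gt0 sv' vn0.
Qed.

Lemma green_unique b m alpha o G G' :
  is_green b m alpha o G -> is_green b m alpha o G' -> G = G'.
Proof.
move=> [cG minG] [cG' minG']; apply/funext => x.
by apply/le_anti; rewrite minG// minG'.
Qed.

Lemma green_eq b m alpha o G : is_green b m alpha o G -> green b m alpha o = G.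
Proof.
move=> gG; rewrite /green; case: xgetP => [G' -> gG'|/(_ G)//].
exact: green_unique gG' gG.
Qed.

End operators.

(** * The Dirichlet problem on a finite set, by Perron's method *)
Section finite_problem.
Context {R : realType} {X : discreteTopologicalType}.
Variables (b : X -> X -> R) (bg : is_graph b).
Variables (K : seq X) (d s : X -> R).
Hypothesis s0 : forall x, 0 <= s x.
Hypothesis d0 : forall x, x \in K -> 0 < d x.
Implicit Types (f g : X -> R) (x y : X).

Definition fin_supersol f : Prop := (forall x, 0 <= f x) /\
  forall x, x \in K -> s x + \sum_(y <- K) b x y * f y <= d x * f x.

Definition dirichlet_sol x : R :=
  if x \in K then inf [set f x | f in fin_supersol] else 0.

Lemma dirichlet_sol_out x : x \notin K -> dirichlet_sol x = 0.
Proof. by rewrite /dirichlet_sol => /negbTE ->. Qed.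

Lemma fin_supersol_has_lbound x : has_lbound [set f x | f in fin_supersol].
Proof. by exists 0 => _ [f [f0 _] <-]. Qed.

Lemma dirichlet_sol_le f x : fin_supersol f -> dirichlet_sol x <= f x.
Proof.
move=> sf; rewrite /dirichlet_sol; case: ifP => _; last by case: sf.
by apply: ge_inf; [exact: fin_supersol_has_lbound|exists f].
Qed.

Hypothesis feasible : exists f, fin_supersol f.

Lemma dirichlet_sol_ge0 x : 0 <= dirichlet_sol x.
Proof.
rewrite /dirichlet_sol; case: ifP => // _.
have [f sf] := feasible.
by apply: lb_le_inf; [exists (f x), f|move=> _ [g [g0 _] <-]].
Qed.

Lemma fin_supersol_dirichlet_sol : fin_supersol dirichlet_sol.
Proof.
split=> [|x xK]; first exact: dirichlet_sol_ge0.
rewrite mulrC -ler_pdivrMr ?d0// [leRHS]/dirichlet_sol xK.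
have [f sf] := feasible.
apply: lb_le_inf; first by exists (f x), f.
move=> _ [g sg <-]; rewrite ler_pdivrMr ?d0// [leRHS]mulrC.
apply: le_trans (sg.2 _ xK); rewrite lerD2l; apply: ler_sum => y _.
by rewrite ler_wpM2l ?graph_ge0// dirichlet_sol_le.
Qed.

(** A strict inequality at [x] could be used to lower the value at [x] alone:
this preserves the inequality at the other vertices, since lowering decreases
their neighbour sums, and [b x x = 0] makes it an equality at [x]. *)
Lemma dirichlet_sol_eq x : x \in K ->
  s x + \sum_(y <- K) b x y * dirichlet_sol y = d x * dirichlet_sol x.
Proof.
move=> xK; apply/le_anti; rewrite fin_supersol_dirichlet_sol.2//=.
set r := s x + _.
have rd : r / d x <= dirichlet_sol x.
  by rewrite ler_pdivrMr ?d0// mulrC fin_supersol_dirichlet_sol.2.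
(* The function lowered at [x] to the value that solves the equation there. *)
pose f y := if y == x then r / d x else dirichlet_sol y.
have fle y : f y <= dirichlet_sol y by rewrite /f; case: eqP => // ->.
have r0 : 0 <= r.
  rewrite /r addr_ge0// sumr_ge0// => y _.
  by rewrite mulr_ge0 ?graph_ge0 ?dirichlet_sol_ge0.
have sf : fin_supersol f.
  split=> [y|z zK].
    by rewrite /f; case: eqP => // _; rewrite ?dirichlet_sol_ge0// divr_ge0// ltW// d0.
  rewrite [f z]/f; case: eqP => [->|_].
    rewrite mulrCA divff ?gt_eqF ?d0// mulr1 /r lerD2l ler_sum// => y _.
    by rewrite ler_wpM2l ?graph_ge0.
  apply: le_trans (fin_supersol_dirichlet_sol.2 z zK).
  by rewrite lerD2l ler_sum// => y _; rewrite ler_wpM2l ?graph_ge0.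
have := dirichlet_sol_le x sf; rewrite /f eqxx ler_pdivlMr ?d0//.
by rewrite mulrC.
Qed.

End finite_problem.

(** * Finitely supported approximations of the Green function *)
Section exhaustion.
Context {R : realType} {X : discreteTopologicalType}.
Variables (e : nat -> X) (e_surj : forall x, exists i, e i = x).

Definition exhaust n : seq X := undup [seq e i | i <- iota 0 n].

Lemma exhaust_uniq n : uniq (exhaust n).
Proof. exact: undup_uniq. Qed.

Lemma exhaust_le n n' : (n <= n')%N -> {subset exhaust n <= exhaust n'}.
Proof.
move=> nn' x; rewrite !mem_undup => /mapP[i]; rewrite mem_iota => /andP[_ ilt] ->.
by apply/map_f; rewrite mem_iota/= (leq_trans ilt).
Qed.

Lemma exhaust_mem x : exists N, forall n, (N <= n)%N -> x \in exhaust n.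
Proof.
have [i <-] := e_surj x; exists i.+1 => n iltn.
by rewrite mem_undup map_f// mem_iota.
Qed.

End exhaustion.

Section approximation.
Context {R : realType} {X : discreteTopologicalType}.
Variables (b : X -> X -> R) (bg : is_graph b) (bc : graph_connected b).
Variables (m : X -> R) (m0 : forall x, 0 < m x).
Variables (e : nat -> X) (e_surj : forall x, exists i, e i = x).
Variables (o : X) (d : X -> R) (v : X -> R).
Hypothesis v0 : forall x, 0 < v x.
Hypothesis sv : supersol b d (cst 0) v.

Let s x := m x * \1_[set o] x.
Let K := exhaust e.
(** The diagonal of [m (Delta + alpha + 1/(n+1))]. *)
Definition killed n x : R := d x + m x / n.+1%:R.

Definition approx n : X -> R := dirichlet_sol b (K n) (killed n) s.

Lemma source_ge0 x : 0 <= s x.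
Proof. by rewrite mulr_ge0// ltW. Qed.

Lemma killing_gt0 n x : 0 < m x / n.+1%:R :> R.
Proof. by rewrite divr_gt0. Qed.

Lemma supersol_diag_ge0 x : 0 <= d x.
Proof.
have := sv x (isT : uniq [::]); rewrite big_nil add0r.
by rewrite pmulr_lge0.
Qed.

Lemma killed_gt0 n x : 0 < killed n x.
Proof. by rewrite ltr_wpDl ?supersol_diag_ge0 ?killing_gt0. Qed.

Lemma approx_feasible n :
  exists f, fin_supersol b (K n) (killed n) s f.
Proof.
(* The factor that turns the gain [c * m o * v o / (n+1)] at [o] into [m o]. *)
pose c := n.+1%:R / v o.
have c0 : 0 < c by rewrite divr_gt0.
exists (fun x => c * v x); split=> [x|x _]; first by rewrite mulr_ge0 ?ltW.
under eq_bigr do rewrite mulrCA.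
rewrite -mulr_sumr /killed mulrDl addrC lerD//.
  rewrite mulrCA ler_wpM2l ?(ltW c0)//.
  by have := sv x (exhaust_uniq e n); rewrite add0r.
rewrite /s indicE; case: (boolP (x \in _)) => [|_]; last first.
  by rewrite mulr0 !mulr_ge0 ?invr_ge0 ?ltW.
rewrite inE => -> /=; rewrite /c mulr1 divfK ?gt_eqF// divfK ?pnatr_eq0//.
Qed.

Lemma approx_ge0 n x : 0 <= approx n x.
Proof. exact: dirichlet_sol_ge0 (approx_feasible n) x. Qed.

Lemma approx_out n x : x \notin K n -> approx n x = 0.
Proof. exact: dirichlet_sol_out. Qed.

Lemma approx_eq n x : x \in K n ->
  s x + \sum_(y <- K n) b x y * approx n y = killed n x * approx n x.
Proof.
apply: dirichlet_sol_eq; [exact: bg|exact: source_ge0| |exact: approx_feasible].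
by move=> ? _; exact: killed_gt0.
Qed.

Lemma approx_le n f x : (forall y, 0 <= f y) -> supersol b d s f ->
  approx n x <= f x.
Proof.
move=> f0 sf; apply: dirichlet_sol_le; split=> // y _.
apply: le_trans (sf y _ (exhaust_uniq e n)) _.
by rewrite ler_wpM2r// lerDl ltW// killing_gt0.
Qed.

Lemma sum_approx_le n x F : uniq F ->
  \sum_(y <- F) b x y * approx n y <= \sum_(y <- K n) b x y * approx n y.
Proof.
move=> uF; apply: sum_uniq_le_support => // [|y|y yK].
- exact: exhaust_uniq.
- by rewrite mulr_ge0 ?graph_ge0 ?approx_ge0.
- by rewrite approx_out ?mulr0.
Qed.

(** Both the larger set and the smaller killing term make [approx n.+1] a
supersolution of the n-th problem. *)
Lemma approxS n x : approx n x <= approx n.+1 x.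
Proof.
apply: dirichlet_sol_le; split=> [y|y yK]; first exact: approx_ge0.
have yK' : y \in K n.+1 by exact: exhaust_le yK.
apply: (@le_trans _ _ (killed n.+1 y * approx n.+1 y)).
  by rewrite -approx_eq// lerD2l sum_approx_le// exhaust_uniq.
rewrite ler_wpM2r ?approx_ge0// lerD2l ler_wpM2l ?(ltW (m0 _))//.
by rewrite lef_pV2 ?posrE// ler_nat.
Qed.

Lemma approx_nondecreasing x : nondecreasing_seq (approx ^~ x).
Proof. by apply/nondecreasing_seqP => n; exact: approxS. Qed.

(** Harnack's inequality with a constant independent of [n]: at a vertex [z] of
the n-th set, each neighbour satisfies [b z w * g w <= (d z + m z) * g z], and
these bounds multiply along a path.  The set has to contain the vertices
of the path, hence the threshold [N]. *)
Lemma approx_harnack x y : exists C N, 0 <= C /\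
  forall n, (N <= n)%N -> approx n y <= C * approx n x.
Proof.
apply: (@graph_connected_ind _ _ b (fun y => exists C N, 0 <= C /\
  forall n, (N <= n)%N -> approx n y <= C * approx n x) x y bc).
  by exists 1, 0%N; split=> // n _; rewrite mul1r.
move=> z w [C [N [C0 CN]]] zw; have [N' zN'] := exhaust_mem e_surj z.
have D0 : 0 <= (d z + m z) / b z w.
  by rewrite divr_ge0 ?(ltW zw)// addr_ge0 ?supersol_diag_ge0 ?(ltW (m0 _)).
exists ((d z + m z) / b z w * C), (maxn N N'); split; first exact: mulr_ge0.
move=> n; rewrite geq_max => /andP[nN nN'].
rewrite -[_ * C * _]mulrA; apply: (le_trans _ (ler_wpM2l D0 (CN n nN))).
rewrite mulrAC ler_pdivlMr// mulrC.
apply: (@le_trans _ _ (killed n z * approx n z)).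
  rewrite -approx_eq ?zN'//; apply: (@le_trans _ _ (\sum_(y <- [:: w]) b z y * approx n y)).
    by rewrite big_seq1.
  by rewrite ler_wpDl ?source_ge0// sum_approx_le.
rewrite ler_wpM2r ?approx_ge0// lerD2l ler_pdivrMr// ler_peMr ?(ltW (m0 _))//.
by rewrite ler1n.
Qed.

(** Testing the equation of [approx n] against [approx n] itself gives equality
with the killing term; dropping that term only decreases the form. *)
Lemma approx_energy_le n :
  qform b (K n) d (approx n) <= m o * approx n o.
Proof.
apply: (@le_trans _ _ (\sum_(x <- K n) s x * approx n x)).
  rewrite /qform -sumrB big_seq [leRHS]big_seq ler_sum// => x xK.
  have /(congr1 ( *%R^~ (approx n x))) := approx_eq xK.
  rewrite mulrDl mulr_suml => E.
  have -> : s x * approx n x = killed n x * approx n x ^+ 2 -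
      \sum_(y <- K n) b x y * approx n x * approx n y.
    rewrite expr2 mulrA -E.
    under [in X in _ = _ - X]eq_bigr do rewrite mulrAC.
    by rewrite addrK.
  by rewrite lerD2r ler_wpM2r ?sqr_ge0// lerDl ltW// killing_gt0.
have -> : m o * approx n o = \sum_(x <- [:: o]) s x * approx n x.
  by rewrite big_seq1 /s indicE mem_set ?mulr1.
apply: sum_uniq_le_support => //; first exact: exhaust_uniq.
  by move=> y; rewrite mulr_ge0 ?source_ge0 ?approx_ge0.
move=> y; rewrite inE /s indicE => yo; rewrite memNset ?mulr0 ?mul0r//.
by move=> /= yo'; rewrite yo' eqxx in yo.
Qed.

Hypothesis bounded : exists M, forall n, approx n o <= M.

Definition approx_lim x : R := limn (approx ^~ x).

Lemma approx_has_ubound x : has_ubound (range (approx ^~ x)).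
Proof.
have [M oM] := bounded; have [C [N [C0 CN]]] := approx_harnack o x.
exists (C * M) => _ [n _ <-].
apply: (@le_trans _ _ (approx (maxn N n) x)).
  by apply: approx_nondecreasing; rewrite leq_maxr.
by apply: le_trans (CN _ (leq_maxl _ _)) _; rewrite ler_wpM2l.
Qed.

Lemma approx_cvg x : approx ^~ x @ \oo --> approx_lim x.
Proof.
apply: nondecreasing_is_cvgn; first exact: approx_nondecreasing.
exact: approx_has_ubound.
Qed.

Lemma approx_le_lim n x : approx n x <= approx_lim x.
Proof.
apply: (nondecreasing_cvgn_le (u_ := approx ^~ x)); first exact: approx_nondecreasing.
apply: nondecreasing_is_cvgn; first exact: approx_nondecreasing.
exact: approx_has_ubound.
Qed.

Lemma approx_lim_ge0 x : 0 <= approx_lim x.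
Proof. exact: le_trans (approx_ge0 0 x) (approx_le_lim 0 x). Qed.

(** A partial sum passes to the limit in the n-th equation, where the killing
term contributes at most [m x * lim / (n+1)]. *)
Lemma approx_lim_supersol : supersol b d s approx_lim.
Proof.
move=> x F uF; have [N xN] := exhaust_mem e_surj x.
pose l n := s x + \sum_(y <- F) b x y * approx n y.
pose r (n : nat) := d x * approx_lim x + m x * approx_lim x * n.+1%:R^-1.
have lc : l n @[n --> \oo] --> s x + \sum_(y <- F) b x y * approx_lim y.
  apply: cvgD; first exact: cvg_cst.
  apply: cvg_big => [|y _]; first exact: add_continuous.
  by apply: cvgM; [exact: cvg_cst|exact: approx_cvg].
have rc : r n @[n --> \oo] --> d x * approx_lim x.
  rewrite -[X in _ --> X]addr0; apply: cvgD; first exact: cvg_cst.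
  rewrite -(mulr0 (m x * approx_lim x)); apply: cvgM.
    exact: cvg_cst.
  exact: cvg_harmonic.
apply: ler_cvg_to lc rc _; exists N => // n /= Nn.
apply: (@le_trans _ _ (killed n x * approx n x)).
  by rewrite -approx_eq ?xN// lerD2l sum_approx_le.
rewrite /r mulrAC -mulrDl ler_wpM2l ?approx_le_lim//.
exact/ltW/killed_gt0.
Qed.

Lemma approx_lim_gt0 x : 0 < approx_lim x.
Proof.
apply: (supersol_gt0 bg bc source_ge0 approx_lim_ge0 approx_lim_supersol).
move=> g0; have := approx_lim_supersol o (isT : uniq [::]).
rewrite g0 big_nil addr0 /= mulr0 /s indicE mem_set//= mulr1.
by rewrite leNgt m0.
Qed.

End approximation.

Section green_function.
Context {R : realType} {X : discreteTopologicalType}.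
Variables (b : X -> X -> R) (bg : is_graph b) (bc : graph_connected b).
Variables (m : X -> R) (m0 : forall x, 0 < m x).
Variables (e : nat -> X) (e_surj : forall x, exists i, e i = x).
Variables (o : X) (alpha : R) (v : X -> R).
Let d := diagonal b m (cst alpha).
Hypothesis v0 : forall x, 0 < v x.
Hypothesis sv : supersol b d (cst 0) v.
Let a := approx b m e o d.

(** Minimality holds because every competitor is above each [approx n]. *)
Lemma green_approx : (exists M, forall n, a n o <= M) ->
  is_green b m alpha o (green b m alpha o) /\
  forall x, a ^~ x @ \oo --> green b m alpha o x.
Proof.
move=> bnd; have gG : is_green b m alpha o (approx_lim b m e o d).
  split.
    apply/green_candidateP => //; split=> [x|].
      exact: (@approx_lim_gt0 _ _ b bg bc m m0 e e_surj o d v v0 sv bnd x).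
    exact: (@approx_lim_supersol _ _ b bg bc m m0 e e_surj o d v v0 sv bnd).
  move=> phi /green_candidateP [//|//|phi0 sphi] x.
  apply: limr_le.
    by apply: (cvgP (approx_lim b m e o d x)); exact: (@approx_cvg _ _ b bg bc m m0 e e_surj o d v v0 sv bnd).
  apply: nearW => n; apply: approx_le => // y; exact/ltW/phi0.
rewrite (green_eq gG); split=> // x.
exact: (@approx_cvg _ _ b bg bc m m0 e e_surj o d v v0 sv bnd).
Qed.

End green_function.

(** * The energy form and the bound at the pole *)
Section energy_form.
Context {R : realType} {X : discreteTopologicalType}.
Variables (b : X -> X -> R) (bg : is_graph b).
Variables (m c : X -> R) (K : seq X) (uK : uniq K) (phi : X -> R).
Hypothesis phi0 : forall x, 0 <= phi x.
Hypothesis phiK : forall x, x \notin K -> phi x = 0.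

Lemma esum_pairs (h : X -> X -> R) (r : X -> R) :
  (forall x y, 0 <= h x y) -> (forall x, finite_tsum (h x)) ->
  (forall x, tsum (h x) = r x) -> (forall x, x \notin K -> r x = 0) ->
  (\esum_(p in [set: X * X]) (h p.1 p.2)%:E)%E = (\sum_(x <- K) r x)%:E.
Proof.
move=> h0 hs hr rK.
have -> : [set: X * X] = setT `*`` (fun=> setT) by apply/seteqP.
rewrite -(@esum_esum _ _ _ _ _ (fun x y => (h x y)%:E))//=; last first.
  by move=> x y _ _; rewrite lee_fin.
under eq_esum => x _ do rewrite -tsum_fin// hr.
have r0 x : 0 <= r x by rewrite -hr tsum_ge0.
by have [rs <-] := tsum_support uK r0 rK; rewrite tsum_fin.
Qed.

(** The square is expanded as [b phi(x)^2 + b phi(y)^2 - 2 b phi(x) phi(y)].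
For nonnegative [phi] the cross term can be moved to the other side, so that
only sums of nonnegative families over pairs occur. *)
Lemma energy_support :
  energy b m c phi = qform b K (diagonal b m c) phi.
Proof.
have b0 := graph_ge0 bg.
have bs x : finite_tsum (b x) by exact: graph_summable bg x.
have E3 : (\esum_(p in [set: X * X]) (phi p.1 ^+ 2 * b p.1 p.2)%:E)%E =
    (\sum_(x <- K) phi x ^+ 2 * tsum (b x))%:E.
  apply: (@esum_pairs (fun x y => phi x ^+ 2 * b x y)) => [x y|x|x|x xK].
  - by rewrite mulr_ge0 ?sqr_ge0.
  - by apply: finite_tsumZ => //; exact: sqr_ge0.
  - by rewrite tsumZ// sqr_ge0.
  - by rewrite phiK// expr0n mul0r.
have E4 : (\esum_(p in [set: X * X]) (phi p.2 ^+ 2 * b p.1 p.2)%:E)%E =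
    (\sum_(x <- K) phi x ^+ 2 * tsum (b x))%:E.
  rewrite -E3 (@reindex_esum _ _ _ [set: X * X] [set: X * X] (fun p => (p.2, p.1))).
  - by apply: eq_esum => -[x y] _ /=; rewrite (graph_sym bg).
  - split=> // [[x y] [x' y'] _ _ [-> ->]//|[x y] _]; by exists (y, x).
have E2 : (\esum_(p in [set: X * X]) (2 * (b p.1 p.2 * phi p.1 * phi p.2))%:E)%E =
    (\sum_(x <- K) \sum_(y <- K) 2 * (b x y * phi x * phi y))%:E.
  have nneg x y : 0 <= 2 * (b x y * phi x * phi y) by rewrite !mulr_ge0.
  have offK x y : y \notin K -> 2 * (b x y * phi x * phi y) = 0.
    by move=> yK; rewrite (phiK yK) !mulr0.
  apply: (@esum_pairs (fun x y => 2 * (b x y * phi x * phi y))) => // [x|x|x xK].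
  - by have [] := tsum_support uK (nneg x) (offK x).
  - by have [] := tsum_support uK (nneg x) (offK x).
  - by rewrite big1// => y _; rewrite (phiK xK) mulr0 mul0r mulr0.
have add : (\esum_(p in [set: X * X]) (b p.1 p.2 * (phi p.1 - phi p.2) ^+ 2)%:E +
    \esum_(p in [set: X * X]) (2 * (b p.1 p.2 * phi p.1 * phi p.2))%:E =
    \esum_(p in [set: X * X]) (phi p.1 ^+ 2 * b p.1 p.2)%:E +
    \esum_(p in [set: X * X]) (phi p.2 ^+ 2 * b p.1 p.2)%:E)%E.
  have nneg1 p : 0 <= b p.1 p.2 * (phi p.1 - phi p.2) ^+ 2.
    by rewrite mulr_ge0 ?sqr_ge0.
  have nneg2 p : 0 <= 2 * (b p.1 p.2 * phi p.1 * phi p.2) by rewrite !mulr_ge0.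
  have nneg3 (p q r : X) : 0 <= phi p ^+ 2 * b q r by rewrite mulr_ge0 ?sqr_ge0.
  rewrite -!esumD; try by move=> *; rewrite lee_fin.
  by apply: eq_esum => -[x y] _ /=; rewrite -!EFinD; congr EFin; ring.
rewrite /energy; move: add; rewrite E2 E3 E4 -EFinD.
set A := (\esum_(p in _) _)%E; case: A => //= r [].
rewrite -(@fsbig_widen _ _ _ _ [set` K] [set: X])//; last first.
  by move=> x /= [_ xK]; rewrite phiK ?expr0n ?mulr0//; exact/negP.
rewrite -fsbig_seq// => /(canRL (addrK _)) ->.
under [\sum_(x <- K) \sum_(y <- K) 2 * _]eq_bigr do rewrite -mulr_sumr.
rewrite -mulr_sumr.
have half (p q : R) : 2^-1 * (p + p - 2 * q) = p - q by field.
rewrite half /qform addrAC -big_split/=; congr (_ - _); apply: eq_bigr => x _.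
by rewrite /diagonal; ring.
Qed.

End energy_form.

Section boundedness.
Context {R : realType} {X : discreteTopologicalType}.
Variables (b : X -> X -> R) (bg : is_graph b) (bc : graph_connected b).
Variables (m : X -> R) (m0 : forall x, 0 < m x).
Variables (e : nat -> X) (e_surj : forall x, exists i, e i = x).
Variable o : X.

Lemma approx_bounded_one :
  supersol b (diagonal b m (cst 1)) (fun x => m x * \1_[set o] x) (cst 1) /\
  forall n, approx b m e o (diagonal b m (cst 1)) n o <= 1.
Proof.
have s1 : supersol b (diagonal b m (cst 1)) (fun x => m x * \1_[set o] x) (cst 1).
  move=> x F uF; rewrite /diagonal /= !mulr1 addrC lerD//.
    under eq_bigr do rewrite mulr1.
    apply: finite_sum_le_tsum => //; first exact: graph_ge0.
    exact: graph_summable.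
  by rewrite ler_piMr ?(ltW (m0 _))// indicE; case: (_ \in _).
by split=> // n; apply: approx_le.
Qed.

(** At a vertex [z] where the Hardy weight is positive,
[m z * W z * g_n z ^ 2 <= energy g_n <= m o * g_n o <= m o * C * g_n z], with
the Harnack constant [C]; this bounds [g_n z], hence also [g_n o]. *)
Lemma approx_bounded_subcritical (alpha : R) :
  subcritical b m (cst alpha) ->
  exists M, forall n, approx b m e o (diagonal b m (cst alpha)) n o <= M.
Proof.
move=> [/(positive_op_supersol bg m0 bc)[v [v0 sv]] [W [[W0 Wn0] hardy]]].
have [z Wz] : exists z, 0 < W z.
  apply: contrapT => noz; apply: Wn0; apply/funext => x; apply/le_anti.
  by rewrite W0 andbT leNgt; apply/negP => Wx; apply: noz; exists x.
set d := diagonal b m (cst alpha) in sv *.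
have [C [N [C0 CN]]] := approx_harnack bg bc m0 e_surj o v0 sv z o.
pose a := approx b m e o d.
have a0 n x : 0 <= a n x by exact: (approx_ge0 m0 e o v0 sv).
have bnd n : (N <= n)%N -> a n z <= m o * C / (m z * W z).
  move=> Nn; rewrite ler_pdivlMr ?mulr_gt0//.
  have [/eqP ->|az] := boolP (a n z == 0).
    by rewrite mul0r mulr_ge0// ltW.
  have az0 : 0 < a n z by rewrite lt_neqAle eq_sym az a0.
  rewrite -(ler_pM2r az0) -[leRHS]mulrA.
  apply: (@le_trans _ _ (m o * a n o)); last by rewrite ler_wpM2l ?CN// ltW.
  have uK := exhaust_uniq e n.
  have aK x : x \notin exhaust e n -> a n x = 0 by exact: approx_out.
  apply: le_trans (approx_energy_le bg m0 e o v0 sv n).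
  rewrite -(energy_support bg m (cst alpha) uK (a0 n) aK).
  have fs : finitely_supported (a n).
    apply: (@sub_finite_set _ _ [set` exhaust e n]); last exact: finite_seq.
    by move=> x /=; apply: contraNT => /aK ->.
  apply: le_trans (hardy _ fs).
  rewrite -(@fsbig_widen _ _ _ _ [set` exhaust e n] [set: X])//; last first.
    by move=> x /= [_ xK]; rewrite aK ?expr0n ?mulr0//; exact/negP.
  rewrite -fsbig_seq//.
  rewrite [leLHS](_ : _ = \sum_(x <- [:: z]) m x * W x * a n x ^+ 2); last first.
    by rewrite big_seq1; ring.
  apply: sum_uniq_le_support => // x; first by rewrite mulr_ge0 ?sqr_ge0// mulr_ge0// ltW.
  by move=> /aK ->; rewrite expr0n mulr0.
exists (C * (m o * C / (m z * W z))) => n.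
apply: (@le_trans _ _ (a (maxn N n) o)).
  exact: (approx_nondecreasing bg m0 e o v0 sv _ (leq_maxr _ _)).
by apply: le_trans (CN _ (leq_maxl _ _)) _; rewrite ler_wpM2l// bnd// leq_maxl.
Qed.

End boundedness.

(** * Ground state representation and Liouville comparison *)
Section quadratic_form.
Context {R : realType} {X : discreteTopologicalType}.
Variables (b : X -> X -> R) (bg : is_graph b) (K : seq X) (uK : uniq K).
Implicit Types (d f g phi v w : X -> R) (x y : X).

Definition edge_energy f phi : R :=
  2^-1 * \sum_(x <- K) \sum_(y <- K) b x y * f x * f y * (phi x - phi y) ^+ 2.

(** Symmetry of [b] turns the mixed term [phi x * phi y] into
[phi x ^ 2 - (phi x - phi y) ^ 2 / 2]; the part with [phi x ^ 2] completes the
diagonal to [m (Delta + c) f] restricted to [K]. *)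
Lemma qform_ground_state d f phi : qform b K d (fun x => f x * phi x) =
  \sum_(x <- K) phi x ^+ 2 * (f x * (d x * f x - \sum_(y <- K) b x y * f y))
  + edge_energy f phi.
Proof.
pose S := \sum_(x <- K) \sum_(y <- K) b x y * f x * f y * phi x ^+ 2.
pose S' := \sum_(x <- K) \sum_(y <- K) b x y * f x * f y * phi y ^+ 2.
pose P := \sum_(x <- K) \sum_(y <- K) b x y * (f x * phi x) * (f y * phi y).
have SS' : S' = S.
  rewrite /S' exchange_big; apply: eq_bigr => x _; apply: eq_bigr => y _.
  by rewrite (graph_sym bg y x); ring.
have -> : edge_energy f phi = S - P.
  rewrite /edge_energy; have -> : S - P = 2^-1 * (S + S' - 2 * P).
    by rewrite SS'; field.
  congr (_ * _); rewrite /P /S /S' mulr_sumr -big_split -sumrB.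
  apply: eq_bigr => x _; rewrite mulr_sumr -big_split -sumrB.
  by apply: eq_bigr => y _ /=; ring.
rewrite /qform -/P addrA; congr (_ - _); rewrite /S -big_split.
apply: eq_bigr => x _ /=.
have -> : \sum_(y <- K) b x y * f x * f y * phi x ^+ 2 =
    phi x ^+ 2 * (f x * \sum_(y <- K) b x y * f y).
  by rewrite !mulr_sumr; apply: eq_bigr => y _; ring.
by ring.
Qed.

Lemma adj_tail_ge0 f x : (forall y, 0 <= f y) -> in_domain b f ->
  0 <= adj b f x - \sum_(y <- K) b x y * f y.
Proof.
move=> f0 df; rewrite subr_ge0 finite_sum_le_tsum// => y.
by rewrite mulr_ge0 ?graph_ge0.
Qed.

(** A rearrangement of the fact that the sum over [K] of the nonnegative family
[b x y * (C * g y - f y)] is at most its total sum. *)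
Lemma adj_tail_le f g C x : (forall y, 0 <= f y) -> (forall y, 0 <= g y) ->
  0 <= C -> in_domain b g -> (forall y, f y <= C * g y) ->
  adj b f x - \sum_(y <- K) b x y * f y <=
  C * (adj b g x - \sum_(y <- K) b x y * g y).
Proof.
move=> f0 g0 C0 dg fg; have b0 := graph_ge0 bg.
have bg0 y : 0 <= b x y * g y by rewrite mulr_ge0.
have bh0 y : 0 <= b x y * (C * g y - f y) by rewrite mulr_ge0 ?subr_ge0.
have bf0 y : 0 <= b x y * f y by rewrite mulr_ge0.
have sCg : finite_tsum (fun y => C * (b x y * g y)) by apply: finite_tsumZ => //; exact: dg.
have sf : finite_tsum (fun y => b x y * f y).
  by apply: finite_tsum_dominated sCg => y; rewrite mulrCA ler_wpM2l.
have sh : finite_tsum (fun y => b x y * (C * g y - f y)).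
  apply: finite_tsum_dominated sCg => y; rewrite mulrCA ler_wpM2l//.
  by rewrite lerBlDr lerDl.
have := finite_sum_le_tsum bh0 sh uK.
have CG : C * adj b g x =
    tsum (fun y => b x y * (C * g y - f y)) + adj b f x.
  rewrite /adj -tsumD// -tsumZ//.
  by congr tsum; apply/funext => y; ring.
rewrite mulrBr CG.
have -> : \sum_(y <- K) b x y * (C * g y - f y) =
    C * \sum_(y <- K) b x y * g y - \sum_(y <- K) b x y * f y.
  by rewrite mulr_sumr -sumrB; apply: eq_bigr => y _; ring.
lra.
Qed.

Lemma qform_supersol d v phi : (forall x, 0 <= v x) ->
  supersol b d (cst 0) v ->
  edge_energy v phi <= qform b K d (fun x => v x * phi x).
Proof.
move=> v0 sv; rewrite qform_ground_state lerDr sumr_ge0// => x _.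
rewrite mulr_ge0 ?sqr_ge0// mulr_ge0// subr_ge0.
by have := sv x K uK; rewrite add0r.
Qed.

Lemma edge_energy_ge v phi x y : (forall x, 0 <= v x) -> x \in K -> y \in K ->
  2^-1 * (b x y * v x * v y * (phi x - phi y) ^+ 2) <= edge_energy v phi.
Proof.
move=> v0 xK yK; rewrite ler_wpM2l//.
have t0 z z' : 0 <= b z z' * v z * v z' * (phi z - phi z') ^+ 2.
  by rewrite mulr_ge0 ?sqr_ge0// !mulr_ge0// graph_ge0.
rewrite (big_rem x xK)/= -[leLHS]addr0 lerD ?sumr_ge0// => [|z _]; last first.
  by rewrite sumr_ge0.
by rewrite (big_rem y yK)/= lerDl sumr_ge0.
Qed.

(** In the ground state representations of both sides, the edge energies are
compared through [w x * w y <= C ^ 2 * G x * G y].  The remaining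
diagonal terms reduce, by the sub- and supersolution properties, to the
neighbour sums outside [K], which are compared by [adj_tail_le]. *)
Lemma qform_comparison d d' s w G C phi :
  0 <= C -> (forall x, 0 <= G x) -> (forall x, 0 <= w x <= C * G x) ->
  (forall x, w x * (d x * w x) <= w x * adj b w x) ->
  supersol b d' s G ->
  qform b K d (fun x => w x * phi x) <=
  C ^+ 2 * (qform b K d' (fun x => G x * phi x) -
            \sum_(x <- K) phi x ^+ 2 * (G x * s x)).
Proof.
move=> C0 G0 wG sw sG; have b0 := graph_ge0 bg.
have w0 x : 0 <= w x by have /andP[] := wG x.
have wCG x : w x <= C * G x by have /andP[] := wG x.
have dG := supersol_in_domain sG.
rewrite !qform_ground_state addrAC mulrDr lerD//.
  rewrite -sumrB mulr_sumr ler_sum// => x _.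
  rewrite -mulrBr [leRHS]mulrCA ler_wpM2l ?sqr_ge0//.
  pose rw := adj b w x - \sum_(y <- K) b x y * w y.
  pose rG := adj b G x - \sum_(y <- K) b x y * G y.
  apply: (@le_trans _ _ (w x * rw)).
    by rewrite !mulrBr lerD2r.
  apply: (@le_trans _ _ ((C * G x) * (C * rG))).
    apply: ler_pM => //; last exact: adj_tail_le.
    apply: adj_tail_ge0 => // z; apply: (@finite_tsum_dominated _ _ _ (fun y => C * (b z y * G y))).
      by move=> y; rewrite mulrCA ler_wpM2l.
    by apply: finite_tsumZ => // y; rewrite mulr_ge0.
  have -> : C * G x * (C * rG) = C ^+ 2 * (G x * rG) by ring.
  rewrite ler_wpM2l ?sqr_ge0// -mulrBr ler_wpM2l// /rG.
  have := supersol_adj x bg G0 sG; lra.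
rewrite /edge_energy [leRHS]mulrCA ler_wpM2l// mulr_sumr ler_sum// => x _.
rewrite mulr_sumr ler_sum// => y _; rewrite [leRHS]mulrA ler_wpM2r ?sqr_ge0//.
have -> : C ^+ 2 * (b x y * G x * G y) = b x y * ((C * G x) * (C * G y)) by ring.
by rewrite -[leLHS]mulrA ler_wpM2l// ler_pM.
Qed.

End quadratic_form.

Section liouville_comparison.
Context {R : realType} {X : discreteTopologicalType}.
Variables (b : X -> X -> R) (bg : is_graph b) (bc : graph_connected b).
Variables (m : X -> R) (m0 : forall x, 0 < m x).
Variables (e : nat -> X) (e_surj : forall x, exists i, e i = x).
Variables (o : X) (d d' : X -> R) (v' G v w : X -> R) (C : R).
Hypotheses (v'0 : forall x, 0 < v' x) (sv' : supersol b d' (cst 0) v').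
Hypotheses (G0 : forall x, 0 < G x)
  (sG : supersol b d' (fun x => m x * \1_[set o] x) G)
  (approxG : forall x, approx b m e o d' ^~ x @ \oo --> G x).
Hypotheses (v0 : forall x, 0 < v x) (sv : supersol b d (cst 0) v).
Hypotheses (C0 : 0 <= C) (wG : forall x, 0 <= w x <= C * G x)
  (sw : forall x, w x * (d x * w x) <= w x * adj b w x).

Let a n x := approx b m e o d' n x.

(** The upper and lower bounds for the energy of [w * (a n / G)], the latter
with [w * (a n / G) = v * (w / v * (a n / G))] restricted to one edge. *)
Lemma gradient_ratio_le n x y :
  o \in exhaust e n -> x \in exhaust e n -> y \in exhaust e n ->
  2^-1 * (b x y * v x * v y *
    (w x / v x * (a n x / G x) - w y / v y * (a n y / G y)) ^+ 2) <=
  C ^+ 2 * (m o * (a n o - a n o * (a n o / G o))).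
Proof.
move=> oK xK yK; have uK := exhaust_uniq e n.
pose chi z := w z / v z * (a n z / G z).
have := @edge_energy_ge _ _ b bg _ v chi x y (fun z => ltW (v0 z)) xK yK.
rewrite /chi; move/le_trans; apply.
apply: le_trans (qform_supersol bg uK _ (fun z => ltW (v0 z)) sv) _.
have -> : (fun z => v z * (w z / v z * (a n z / G z))) =
    (fun z => w z * (a n z / G z)).
  by apply/funext => z; rewrite mulrA [v z * _]mulrC divfK ?gt_eqF.
apply: le_trans (qform_comparison bg uK _ C0 (fun z => ltW (G0 z)) wG sw sG) _.
rewrite ler_wpM2l ?sqr_ge0// mulrBr lerB//.
  have -> : (fun z => G z * (a n z / G z)) = a n.
    by apply/funext => z; rewrite mulrCA divff ?gt_eqF// mulr1.
  exact: (approx_energy_le bg m0 e o v'0 sv').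
have -> : m o * (a n o * (a n o / G o)) =
    \sum_(z <- [:: o]) (a n z / G z) ^+ 2 * (G z * (m z * \1_[set o] z)).
  by rewrite big_seq1 indicE mem_set//=; field; rewrite gt_eqF.
rewrite (@sum_restrict _ _ [:: o] (exhaust e n))// => [z|z].
  by rewrite inE => /eqP ->.
by rewrite inE => /eqP zo; rewrite indicE memNset ?mulr0.
Qed.

(** The right-hand side of [gradient_ratio_le] tends to 0 because
[a n o -> G o], whereas [a n / G -> 1] pointwise on the left. *)
Lemma ratio_constant x y : w x / v x = w y / v y.
Proof.
apply: (@graph_connected_ind _ _ b (fun z => w x / v x = w z / v z) x y bc) => //.
move=> z t -> zt.
pose P z' := w z' / v z'.
have ratio z' : a n z' / G z' @[n --> \oo] --> (1 : R).
  rewrite -(divff (lt0r_neq0 (G0 z'))); apply: cvgM; last exact: cvg_cst.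
  exact: approxG.
have scaled z' : P z' * (a n z' / G z') @[n --> \oo] --> P z'.
  rewrite -[X in _ --> X]mulr1; apply: cvgM; [exact: cvg_cst|exact: ratio].
pose l n := 2^-1 * (b z t * v z * v t *
    (P z * (a n z / G z) - P t * (a n t / G t)) ^+ 2).
pose r n := C ^+ 2 * (m o * (a n o - a n o * (a n o / G o))).
have lc : l n @[n --> \oo] --> 2^-1 * (b z t * v z * v t * (P z - P t) ^+ 2).
  apply: cvgM; first exact: cvg_cst.
  apply: cvgM; first exact: cvg_cst.
  by under eq_fun do rewrite expr2; rewrite expr2; apply: cvgM; apply: cvgB.
have rc : r n @[n --> \oo] --> C ^+ 2 * (m o * (G o - G o * 1)).
  apply: cvgM; first exact: cvg_cst.
  apply: cvgM; first exact: cvg_cst.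
  by apply: cvgB; [exact: approxG|apply: cvgM; [exact: approxG|exact: ratio]].
have [No oN] := exhaust_mem e_surj o; have [Nz zN] := exhaust_mem e_surj z.
have [Nt tN] := exhaust_mem e_surj t.
have : 2^-1 * (b z t * v z * v t * (P z - P t) ^+ 2) <= 0.
  rewrite [leRHS](_ : 0 = C ^+ 2 * (m o * (G o - G o * 1))); last first.
    by rewrite mulr1 subrr !mulr0.
  apply: ler_cvg_to lc rc _; exists (maxn No (maxn Nz Nt)) => // n /=.
  rewrite !geq_max => /and3P[Non Nzn Ntn].
  by apply: gradient_ratio_le; [exact: oN|exact: zN|exact: tN].
rewrite pmulr_rle0// pmulr_rle0 ?mulr_gt0// => sq.
have /eqP : (P z - P t) ^+ 2 = 0 by apply/le_anti; rewrite sq sqr_ge0.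
by rewrite sqrf_eq0 subr_eq0 => /eqP.
Qed.

End liouville_comparison.

(** * Sign of harmonic functions *)
Section harmonic_functions.
Context {R : realType} {X : discreteTopologicalType}.
Variables (b : X -> X -> R) (bg : is_graph b) (bc : graph_connected b).
Variables (m : X -> R) (m0 : forall x, 0 < m x).

Definition pos_part (f : X -> R) x : R := Num.max (f x) 0.

Lemma pos_part_ge0 f x : 0 <= pos_part f x.
Proof. by rewrite /pos_part le_max lexx orbT. Qed.

Lemma pos_part_le_norm f x : pos_part f x <= `|f x|.
Proof. by rewrite /pos_part ge_max ler_norm normr_ge0. Qed.

Lemma pos_partB f x : pos_part f x - pos_part (fun y => - f y) x = f x.
Proof. by rewrite /pos_part /Num.max; case: ltP => ?; case: ltP => ?; lra. Qed.


Lemma schrodinger_parts V u x : formal_domain b u ->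
  m x * schrodinger b m V u x = diagonal b m V x * u x -
    (adj b (pos_part u) x - adj b (pos_part (fun y => - u y)) x).
Proof.
move=> du; have b0 := graph_ge0 bg.
have dom f : (forall y, `|f y| = `|u y|) -> in_domain b (pos_part f).
  move=> fu z; apply: finite_tsum_dominated (du z) => y.
  by rewrite ler_wpM2l// -fu pos_part_le_norm.
rewrite -[in RHS](pos_partB u x) -schrodinger_split//.
- by congr (_ * schrodinger _ _ _ _ _); apply/funext => y; rewrite pos_partB.
- exact: pos_part_ge0.
- exact: pos_part_ge0.
- exact: dom.
- by apply: dom => y; rewrite normrN.
Qed.

Lemma harmonicE V u x : schrodinger_harmonic b m V u ->
  diagonal b m V x * u x =
    adj b (pos_part u) x - adj b (pos_part (fun y => - u y)) x.
Proof.
move=> [du hu]; have /esym/eqP := schrodinger_parts V x du.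
by rewrite hu mulr0 subr_eq0 => /eqP.
Qed.

Lemma harmonicN V u : schrodinger_harmonic b m V u ->
  schrodinger_harmonic b m V (fun y => - u y).
Proof.
move=> hu; have [du _] := hu.
have duN : formal_domain b (fun y => - u y).
  by move=> x /=; under eq_esum do rewrite normrN; exact: du.
split=> // x; apply: (mulfI (lt0r_neq0 (m0 x))).
rewrite schrodinger_parts// mulr0 mulrN (harmonicE x hu).
have -> : (fun y => - - u y) = u by apply/funext => y; rewrite opprK.
by ring.
Qed.

(** Where [u > 0], passing from [u] to its positive part drops the negative
contributions to the neighbour sum; the factor [pos_part u x] makes the
inequality trivial elsewhere. *)
Lemma harmonic_pos_part_subsol V u x : schrodinger_harmonic b m V u ->
  pos_part u x * (diagonal b m V x * pos_part u x) <=
  pos_part u x * adj b (pos_part u) x.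
Proof.
move=> hu; have b0 := graph_ge0 bg.
have [ux|ux] := ltP 0 (u x); last by rewrite /pos_part (max_r ux) !mul0r.
have E : pos_part u x = u x by rewrite /pos_part (max_l (ltW ux)).
rewrite E ler_wpM2l ?(ltW ux)// (harmonicE x hu) lerBlDr lerDl.
by apply: tsum_ge0 => y; rewrite mulr_ge0// pos_part_ge0.
Qed.

Lemma harmonic_ge0_supersol V u : schrodinger_harmonic b m V u ->
  (forall x, 0 <= u x) -> supersol b (diagonal b m V) (cst 0) u.
Proof.
move=> [du hu] u0 x F uF.
have := (supersolP V (cst 0) bg m0 u0).1 (conj du _) x F uF.
by rewrite mulr0; apply=> y; rewrite hu.
Qed.

Variables (e : nat -> X) (e_surj : forall x, exists i, e i = x).
Variables (o : X) (alpha : R) (v' G : X -> R) (C : R).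
Let d' := diagonal b m (cst alpha).
Hypotheses (v'0 : forall x, 0 < v' x) (sv' : supersol b d' (cst 0) v').
Hypotheses (gG : is_green b m alpha o G)
  (approxG : forall x, approx b m e o d' ^~ x @ \oo --> G x).

Lemma harmonic_sign V u : positive_op b m V -> schrodinger_harmonic b m V u ->
  0 <= C -> (forall x, `|u x| <= C * G x) ->
  (forall x, u x <= 0) \/ (forall x, 0 < u x).
Proof.
move=> posV hu C0 uG.
have [v [v0 sv]] := positive_op_supersol bg m0 bc posV.
have [/green_candidateP [//|//|G0 sG] _] := gG.
have wG x : 0 <= pos_part u x <= C * G x.
  by rewrite pos_part_ge0 (le_trans (pos_part_le_norm _ _)).
have rc := ratio_constant bg bc m0 e_surj v'0 sv' G0 sG approxG v0 sv C0 wG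
  (fun x => harmonic_pos_part_subsol x hu).
have [neg|/existsNP[z /negP]] := pselect (forall x, u x <= 0); first by left.
rewrite -ltNge => uz; right=> x.
have : 0 < pos_part u x / v x.
  by rewrite (rc x z) divr_gt0// /pos_part lt_max uz.
by rewrite pmulr_lgt0 ?invr_gt0// /pos_part lt_max ltxx orbF.
Qed.

End harmonic_functions.

(** * Behaviour at infinity *)
Section minimum_principle.
Context {R : realType} {X : discreteTopologicalType}.
Variables (b : X -> X -> R) (bg : is_graph b).
Variables (m : X -> R) (m0 : forall x, 0 < m x).

(** The minimum of [G] and [G o / t o * t] is again a competitor for the Green
function: the two functions agree at [o], so the source only has to be
accounted for where the minimum is [G]. *)
Lemma green_le_supersol alpha o G t : is_green b m alpha o G ->
  (forall x, 0 < t x) -> supersol b (diagonal b m (cst alpha)) (cst 0) t ->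
  forall x, G x <= G o / t o * t x.
Proof.
move=> [/green_candidateP [//|//|G0 sG] minG] t0 st.
pose f x := Num.min (G x) (G o / t o * t x).
have b0 := graph_ge0 bg.
have C0 : 0 < G o / t o by rewrite divr_gt0.
have fG x : f x <= G x by rewrite /f ge_min lexx.
have ft x : f x <= G o / t o * t x by rewrite /f ge_min lexx orbT.
suff cf : green_candidate b m alpha o f.
  by move=> x; exact: le_trans (minG _ cf x) (ft x).
apply/green_candidateP => //; split=> [x|x F uF].
  by rewrite /f lt_min G0 mulr_gt0.
have [Gt|tG] := leP (G x) (G o / t o * t x).
  rewrite {2}/f (min_l Gt); apply: le_trans (sG x F uF).
  by rewrite lerD2l ler_sum// => y _; rewrite ler_wpM2l.
have xo : x != o.
  by apply/eqP => xo; move: tG; rewrite xo divfK ?ltxx// gt_eqF.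
rewrite {2}/f (min_r (ltW tG)) indicE memNset ?mulr0 ?add0r; last exact/eqP.
rewrite mulrCA; apply: (@le_trans _ _ (G o / t o * \sum_(y <- F) b x y * t y)).
  rewrite mulr_sumr ler_sum// => y _.
  by rewrite mulrCA ler_wpM2l.
by rewrite ler_wpM2l ?(ltW C0)//; have := st x F uF; rewrite add0r.
Qed.

End minimum_principle.

Section limits_at_infinity.
Context {R : realType} {X : discreteTopologicalType}.
Implicit Types (f g : X -> R).

(** The bound holds off a finite set; the finitely many exceptional quotients
are absorbed by adding all of them to the constant. *)
Lemma in_bigO_bound f g : (forall x, 0 < g x) -> in_bigO f g ->
  exists C, 0 <= C /\ forall x, `|f x| <= C * g x.
Proof.
move=> g0 /ereal_inf_lt [_ [A Afin <-]] supA.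
set S := ereal_sup _ in supA.
have SA x : A x -> `|f x| <= Num.max (fine S) 0 * g x.
  move=> Ax; rewrite -ler_pdivrMr// le_max; apply/orP; left.
  have : ((`|f x| / `|g x|)%:E <= S)%E by apply: ereal_sup_ubound; exists x.
  by rewrite (gtr0_norm (g0 x)); case: S supA.
have [F AF] := (finite_seqP _).1 Afin.
exists (Num.max (fine S) 0 + \sum_(y <- F) `|f y| / g y).
have S0 : 0 <= Num.max (fine S) 0 by rewrite le_max lexx orbT.
have t0 y : 0 <= `|f y| / g y by rewrite divr_ge0// ltW.
split=> [|x]; first by rewrite addr_ge0// sumr_ge0.
have [/SA fS|nA] := pselect (A x).
  by apply: le_trans fS _; rewrite ler_wpM2r ?(ltW (g0 _))// lerDl sumr_ge0.
have xF : x \in F by have : (~` A) x by []; rewrite AF.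
rewrite -ler_pdivrMr// ler_wpDl// (big_rem x xF)/= lerDl; apply: sumr_ge0 => y _; exact: t0.
Qed.

Lemma limf_einf_ge f (delta : R) : (forall x, delta <= f x) ->
  (delta%:E <= limf_einf (fun x => (f x)%:E) (@at_infty X))%E.
Proof.
move=> df; rewrite limf_einfE.
apply: (@le_trans _ _ (ereal_inf ((fun x => (f x)%:E) @` setT))).
  by apply: le_ereal_inf_tmp => _ [x _ <-]; rewrite lee_fin.
apply: ereal_sup_ubound; exists setT => //.
by rewrite /at_infty/= setCT.
Qed.

End limits_at_infinity.

Theorem corollary3p5 (R : realType) (X : discreteTopologicalType)
    (X_countable : countable [set: X]) (X_infinite : infinite_set [set: X])
    (m : X -> R) (m_gt0 : forall x, 0 < m x)
    (b : X -> X -> R) (b_graph : is_graph b) (b_conn : graph_connected b)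
    (o : X)
    (V : X -> R) (V_le1 : forall x, V x <= 1)
    (H_pos : positive_op b m V)
    (alpha : R) (alpha_subcrit : subcritical b m (cst alpha))
    (u : X -> R) (u_harm : schrodinger_harmonic b m V u)
    (u_bigO : in_bigO u (green b m alpha o))
    (u_liminf : limf_einf (fun x => (`|u x| / green b m 1 o x)%:E) at_infty
                = 0%E) :
  u = cst 0.
Proof.
have [e e_surj] : exists e : nat -> X, forall x, exists i, e i = x.
  have /countable_injP[f f_inj] := X_countable.
  exists (fun n => xget o [set x | f x = n]) => x; exists (f x).
  case: xgetP => [y -> fy|/(_ x)[]//].
  by apply: f_inj; rewrite ?inE.
have [v [v0 sv]] := positive_op_supersol b_graph m_gt0 b_conn alpha_subcrit.1.
have [gG cvgG] := green_approx b_graph b_conn m_gt0 e_surj v0 sv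
  (approx_bounded_subcritical b_graph b_conn m_gt0 e_surj o alpha_subcrit).
have [G0 _] := (green_candidateP _ _ _ b_graph m_gt0).1 gG.1.
have [C [C0 uG]] := in_bigO_bound G0 u_bigO.
have [s1 bnd1] := approx_bounded_one b_graph m_gt0 e o.
have sv1 : supersol b (diagonal b m (cst 1)) (cst 0) (cst 1).
  move=> x F uF; apply: le_trans (s1 x F uF); rewrite lerD2r.
  by rewrite mulr_ge0// ltW.
have one0 (x : X) : 0 < (cst 1 : X -> R) x by exact: ltr01.
have [gG1 _] := green_approx b_graph b_conn m_gt0 e_surj one0 sv1
  (ex_intro _ 1 bnd1).
have [G10 _] := (green_candidateP _ _ _ b_graph m_gt0).1 gG1.1.
(* Applied to [u] and to [- u]. *)
have no_pos t : (forall x, `|t x| = `|u x|) -> schrodinger_harmonic b m V t ->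
    ~ (forall x, 0 < t x).
  move=> tu ht t0.
  have st : supersol b (diagonal b m (cst 1)) (cst 0) t.
    move=> x F uF; apply: le_trans (harmonic_ge0_supersol b_graph m_gt0 ht (fun x => ltW (t0 x)) x uF) _.
    rewrite ler_wpM2r ?(ltW (t0 x))// lerD2l ler_wpM2l ?(ltW (m_gt0 x))// ?V_le1.
  have Gt := green_le_supersol b_graph m_gt0 gG1 t0 st.
  have lb x : t o / green b m 1 o o <= `|u x| / green b m 1 o x.
    rewrite ler_pdivlMr// -tu gtr0_norm// mulrAC ler_pdivrMr// mulrC.
    by have := Gt x; rewrite mulrAC ler_pdivlMr// [leRHS]mulrC.
  have := limf_einf_ge lb.
  by rewrite u_liminf lee_fin leNgt divr_gt0.
have sign t : (forall x, `|t x| = `|u x|) -> schrodinger_harmonic b m V t ->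
    forall x, t x <= 0.
  move=> tu ht; have tG x : `|t x| <= C * green b m alpha o x by rewrite tu.
  have [//|t0] := harmonic_sign b_graph b_conn m_gt0 e_surj v0 sv gG cvgG H_pos ht C0 tG.
  by have := no_pos t tu ht t0.
apply/funext => x /=; apply/le_anti; rewrite sign//= -oppr_le0.
apply: (sign (fun y => - u y)); first by move=> y; rewrite normrN.
exact: harmonicN.
Qed.
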